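(* Let $\Gamma$ be a transient finitely generated group and let $\mu$ be a finitely supported symmetric probability measure on $\Gamma$ whose support generates $\Gamma$. Let $d_G$ be the Green metric of $\mu$, let $K_y$ ($y\in\Gamma$) be the Martin kernels of $\mu$, and let $\rho(x,y)=d(K_x,K_y)$ for $x,y\in\Gamma$, where $d$ is the Hilbert metric on the cone $\mathcal C$ of positive superharmonic functions on $\Gamma$. Then $$\rho(x,y)=d_G(x,y)\qquad\text{for all }x,y\in\Gamma .$$
   Context: A measure $\mu$ on $\Gamma$ is symmetric if $\mu(g^{-1})=\mu(g)$ for all $g$. The Green kernel of $\mu$ is $G(x,y)=\sum_{n=0}^\infty\mu^{*n}(x^{-1}y)$, where $\mu^{*n}$ is the $n$-fold convolution power and $\mu^{*0}=\delta_e$. The group $\Gamma$ is transient if $G$ is everywhere finite for every finitely supported symmetric probability measure whose support generates $\Gamma$. The Green metric of $\mu$ is $$d_G(x,y)=\log\frac{G(e,e)}{G(x,y)},\qquad x,y\in\Gamma.$$ The Martin kernel at $y\in\Gamma$ is the function $K_y(x)=\frac{G(x,y)}{G(e,y)}$ on $\Gamma$; it is superharmonic, i.e. $K_y*\mu\le K_y$ on $\Gamma$. $\mathcal C$ is the cone of positive superharmonic functions with respect to $\mu$, inside the space of real functions on $\Gamma$ with the pointwise order $f\preceq g\iff f(z)\le g(z)$ for all $z\in\Gamma$. The Hilbert (pseudo-)metric on the projectivization of $\mathcal C$ is $$d(f,g)=\frac12\log\frac{\beta(f,g)}{\alpha(f,g)},\quad \alpha(f,g)=\sup\{\lambda>0:\lambda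 f\preceq g\},\quad \beta(f,g)=\inf\{\lambda>0: g\preceq\lambda f\},$$ with $\alpha=0$, respectively $\beta=\infty$, if the corresponding set is empty. *)

(* Defs.v *)
From HB Require Import structures.
From mathcomp Require Import all_boot all_order all_algebra finmap.
From mathcomp Require Import all_classical all_reals all_analysis.
Set Implicit Arguments.
Unset Strict Implicit.
Unset Printing Implicit Defensive.
Import Order.TTheory GRing.Theory Num.Theory.
Local Open Scope classical_set_scope.
Local Open Scope ring_scope.

(* [groupType] is the MathComp structure of possibly infinite groups. *)

Definition subgroup (Gam : groupType) (H : set Gam) : Prop :=
  H 1%g /\ forall g h, H g -> H h -> H (g * h^-1)%g.

Definition generates (Gam : groupType) (S : set Gam) : Prop :=
  smallest (@subgroup Gam) S = setT.

Definition finitely_generated (Gam : groupType) : Prop :=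
  exists S : set Gam, finite_set S /\ generates S.

(* Measures on the discrete group are represented by their densities. *)
Definition msupp (Gam : groupType) (R : realType) (mu : Gam -> R) : set Gam :=
  [set g | mu g != 0].

Record admissible (Gam : groupType) (R : realType) (mu : Gam -> R) : Prop := {
  adm_ge0 : forall g, 0 <= mu g;
  adm_finsupp : finite_set (msupp mu);
  adm_mass : \sum_(g \in [set: Gam]) mu g = 1;
  adm_sym : forall g, mu g^-1%g = mu g;
  adm_gen : generates (msupp mu)
}.

(* [\sum_(h \in setT)] sums over the support of the summand, which is finite
   as soon as [f] or [g] has finite support; this is always the case below. *)
Definition conv (Gam : groupType) (R : realType) (f g : Gam -> R) : Gam -> R :=
  fun x => \sum_(h \in [set: Gam]) f h * g (h^-1 * x)%g.

Fixpoint conv_pow (Gam : groupType) (R : realType) (mu : Gam -> R) (n : nat) :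
    Gam -> R :=
  if n is n'.+1 then conv mu (conv_pow mu n') else fun g => (g == 1%g)%:R.

Definition green (Gam : groupType) (R : realType) (mu : Gam -> R) (x y : Gam) :
    \bar R :=
  (\sum_(0 <= n <oo) (conv_pow mu n (x^-1 * y)%g)%:E)%E.

Definition transient (R : realType) (Gam : groupType) : Prop :=
  forall mu : Gam -> R, admissible mu ->
  forall x y, green mu x y \is a fin_num.

(* In the next two definitions [fine] is only meaningful when the Green kernel
   is finite. *)
Definition green_metric (Gam : groupType) (R : realType) (mu : Gam -> R)
    (x y : Gam) : R :=
  ln (fine (green mu 1%g 1%g) / fine (green mu x y)).

Definition martin (Gam : groupType) (R : realType) (mu : Gam -> R) (y : Gam) :
    Gam -> R :=
  fun x => fine (green mu x y) / fine (green mu 1%g y).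

(* Positive means strictly positive, so that 0 is excluded and the
   projectivization makes sense. *)
Definition superharmonic_cone (Gam : groupType) (R : realType)
    (mu : Gam -> R) : set (Gam -> R) :=
  [set f | (forall x, 0 < f x) /\ (forall x, conv f mu x <= f x)].

Section Hilbert.
Context (T : Type) (R : realType).
Implicit Types f g : T -> R.

Definition ptle f g : Prop := forall z, f z <= g z.

(* [ereal_sup set0 = -oo], hence the maximum with 0, whereas
   [ereal_inf set0 = +oo] is the required convention. *)
Definition hilbert_alpha f g : \bar R :=
  maxe 0%E (ereal_sup
    [set l%:E | l in [set l : R | 0 < l /\ ptle (fun z => l * f z) g]]).

Definition hilbert_beta f g : \bar R :=
  ereal_inf
    [set l%:E | l in [set l : R | 0 < l /\ ptle g (fun z => l * f z)]].

(* In [\bar R] one has [0^-1 = +oo] and [lne +oo = +oo], so the value is [+oo]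
   when alpha is 0 or beta is infinite. *)
Definition hilbert_metric (C : set (T -> R)) (f g : {f | C f}) : \bar R :=
  ((2^-1)%:E *
   lne (hilbert_beta (sval f) (sval g) / hilbert_alpha (sval f) (sval g)))%E.

End Hilbert.

Section MartinCone.
Context (Gam : groupType) (R : realType) (mu : Gam -> R).
Context (hmu : admissible mu).

Let conv_supp (f : Gam -> R) x :
  conv mu f x = \sum_(h <- fset_set (msupp mu)) mu h * f (h^-1 * x)%g.
Proof.
rewrite /conv; apply: fsbigTE => h; rewrite in_fset_set ?inE; last exact: adm_finsupp.
by rewrite notin_setE /msupp /= => /negP; rewrite negbK => /eqP ->; rewrite mul0r.
Qed.

Lemma conv_pow_ge0 n g : 0 <= conv_pow mu n g.
Proof.
elim: n g => [|n IH] g /=; first exact: ler0n.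
by apply: fsumr_ge0 => h _; apply: mulr_ge0; [exact: adm_ge0|exact: IH].
Qed.

Let conv_pow_step n h g : mu h * conv_pow mu n g <= conv_pow mu n.+1 (h * g)%g.
Proof.
have [h0|hn0] := eqVneq (mu h) 0; first by rewrite h0 mul0r conv_pow_ge0.
rewrite /= conv_supp (big_fsetD1 h) /=; last first.
  by rewrite in_fset_set ?inE//; exact: adm_finsupp.
rewrite mulKg lerDl; apply: sumr_ge0 => k _.
by apply: mulr_ge0; [exact: adm_ge0|exact: conv_pow_ge0].
Qed.

Lemma conv_pow_gt0 g : exists n, 0 < conv_pow mu n g.
Proof.
pose Q h := exists n, 0 < conv_pow mu n h.
pose P g := forall h, Q h -> Q (g * h)%g.
have : smallest (@subgroup Gam) (msupp mu) g by rewrite (adm_gen hmu).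
move=> /(_ [set g | P g /\ P g^-1%g]); case.
- split; first split.
  + by rewrite /= invg1; split => h; rewrite mul1g.
  + move=> a b [Pa Pa'] [Pb Pb']; split => h Qh.
      by rewrite -mulgA; apply/Pa/Pb'.
    by rewrite invgM invgK -mulgA; apply/Pb/Pa'.
  + have S a : mu a != 0 -> P a.
      move=> a0 h [n hn]; exists n.+1; apply: lt_le_trans (conv_pow_step n a h).
      by rewrite mulr_gt0// lt_neqAle eq_sym a0 adm_ge0.
    by move=> a a0; split; apply: S; rewrite ?(adm_sym hmu).
- by move=> /(_ 1%g) + _; rewrite mulg1; apply; exists 0%N; rewrite /= eqxx.
Qed.

Lemma green_gt0 x y : (0 < green mu x y)%E.
Proof.
have [n hn] := conv_pow_gt0 (x^-1 * y)%g.
rewrite /green (nneseriesD1 (n := n))//; last by move=> k _; rewrite lee_fin conv_pow_ge0.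
apply: lt_le_trans (leeDl _ _); rewrite ?lte_fin//.
by apply: nneseries_ge0 => k _ _; rewrite lee_fin conv_pow_ge0.
Qed.

Let green_step (x y : Gam) :
  (\sum_(h <- fset_set (msupp mu)) (mu h)%:E * green mu (x * h)%g y <=
   green mu x y)%E.
Proof.
have E h : ((mu h)%:E * green mu (x * h)%g y =
    \sum_(0 <= n <oo) (mu h)%:E * (conv_pow mu n ((x * h)^-1 * y)%g)%:E)%E.
  by rewrite nneseriesZl// => n _; rewrite lee_fin conv_pow_ge0.
under eq_bigr do rewrite E.
rewrite -nneseries_sum; last first.
  by move=> h n _; rewrite -EFinM lee_fin mulr_ge0// ?(adm_ge0 hmu) ?conv_pow_ge0.
rewrite [leRHS]/green (nneseries_recl (P := xpredT)
  (f := fun n => (conv_pow mu n (x^-1 * y)%g)%:E))//; last first.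
  by move=> k _; rewrite lee_fin conv_pow_ge0.
rewrite -(nneseries_addn (f := fun n => (conv_pow mu n (x^-1 * y)%g)%:E)); last first.
  by move=> k; rewrite lee_fin conv_pow_ge0.
rewrite -[leLHS]add0e leeD ?lee_fin ?conv_pow_ge0//.
rewrite le_eqVlt; apply/orP; left; apply/eqP; apply: eq_eseriesr => n _.
rewrite addn1 /= conv_supp -sumEFin; apply: eq_bigr => h _.
by rewrite EFinM invgM mulgA.
Qed.

Context (trG : transient R Gam).

Lemma martin_in_cone y : superharmonic_cone mu (martin mu y).
Proof.
have Gfin a b := trG hmu a b.
have Gpos a b : 0 < fine (green mu a b) by rewrite -lte_fin fineK// green_gt0.
split => x; first by rewrite /martin divr_gt0.
have -> : conv (martin mu y) mu x =
    (\sum_(h <- fset_set (msupp mu)) mu h * fine (green mu (x * h)%g y)) /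
    fine (green mu 1%g y).
  rewrite /conv (reindex_fsbigT (fun k => x * k)%g); last first.
    by exists (fun k => x^-1 * k)%g => k; rewrite ?mulKg ?mulVKg.
  rewrite mulr_suml; under eq_fsbigr do rewrite invgM -mulgA mulVg mulg1 (adm_sym hmu).
  rewrite (fsbigTE (fset_set (msupp mu))) => [|h].
    by apply: eq_bigr => h _; rewrite /martin mulrC mulrA.
  rewrite in_fset_set; last exact: adm_finsupp.
  by rewrite notin_setE /msupp /= => /negP; rewrite negbK => /eqP ->; rewrite mulr0.
rewrite /martin ler_pM2r ?invr_gt0// -lee_fin fineK// -sumEFin.
apply: le_trans (green_step x y); rewrite le_eqVlt; apply/orP; left; apply/eqP.
by apply: eq_bigr => h _; rewrite EFinM fineK.
Qed.

End MartinCone.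

Definition martin_cone (R : realType) (Gam : groupType)
    (trG : transient R Gam) (mu : Gam -> R) (hmu : admissible mu) (y : Gam) :
    {f : Gam -> R | superharmonic_cone mu f} :=
  exist _ (martin mu y) (martin_in_cone hmu trG y).

Definition martin_dist (R : realType) (Gam : groupType)
    (trG : transient R Gam) (mu : Gam -> R) (hmu : admissible mu) (x y : Gam) :
    \bar R :=
  hilbert_metric (martin_cone trG hmu x) (martin_cone trG hmu y).

(* Main.v *)
Require Import Defs.
From mathcomp Require Import all_boot all_order all_algebra finmap.
From mathcomp Require Import all_classical all_reals all_analysis.

Import Order.TTheory GRing.Theory Num.Theory.
Local Open Scope classical_set_scope.
Local Open Scope ring_scope.

(** Write [G] for the Green kernel and [e] for the unit of the group. Since
      [K_y(z) / K_x(z) = (G(e,x) / G(e,y)) * (G(z,y) / G(z,x))],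
    computing the Hilbert distance amounts to finding the extreme values over
    [z] of [G(z,y) / G(z,x)]. The largest one is reached at [z = y] and the
    smallest one at [z = x], because of the inequality
      [G(z,y) * G(y,x) <= G(e,e) * G(z,x)],
    which in probabilistic terms says that passing through [y] is only one way
    to go from [z] to [x]. The constant [G(e,x) / G(e,y)] cancels in the
    quotient of the two extreme values, which is
      [G(e,e)^2 / (G(x,y) * G(y,x)) = (G(e,e) / G(x,y))^2]
    by symmetry of [G]; the factor [1/2] of the Hilbert metric absorbs the
    square.

    The inequality is an instance of a domination principle
    ([superharmonic_domination]): a nonnegative superharmonic function [f]
    satisfies [G(z,y) * f(y) <= G(e,e) * f(z)]. First-passage times can be
    avoided by proving it for the partial sums of [G(z,y)] by induction on the
    number of terms. Symmetry of [G] comes from that of [mu], which passes to the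
    convolution powers because [mu] commutes with them ([conv_powSr]). *)

Section Green.
Context {R : realType} {Gam : groupType} {mu : Gam -> R}.
Context (hmu : admissible mu).

Local Notation supp := (fset_set (msupp mu)).
Local Notation p := (conv_pow mu).

Lemma convl_finE (f : Gam -> R) x :
  Defs.conv mu f x = \sum_(h <- supp) mu h * f (h^-1 * x)%g.
Proof.
apply: fsbigTE => h; rewrite in_fset_set; last exact: adm_finsupp.
by rewrite notin_setE /msupp /= => /negP/negPn/eqP ->; rewrite mul0r.
Qed.

(** Symmetry of [mu] turns right convolution into the average of [f] after one
    step of the random walk. *)
Lemma convr_finE (f : Gam -> R) x :
  Defs.conv f mu x = \sum_(h <- supp) mu h * f (x * h)%g.
Proof.
rewrite /Defs.conv (reindex_fsbigT (fun k => x * k)%g); last first.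
  by exists (fun k => x^-1 * k)%g => k; rewrite ?mulKg ?mulVKg.
under eq_fsbigr do rewrite invgM -mulgA mulVg mulg1 (adm_sym hmu) mulrC.
apply: fsbigTE => h; rewrite in_fset_set; last exact: adm_finsupp.
by rewrite notin_setE /msupp /= => /negP/negPn/eqP ->; rewrite mul0r.
Qed.

Lemma convr_delta x : Defs.conv mu (fun g => (g == 1%g)%:R) x = mu x.
Proof.
rewrite /Defs.conv (fsbigTE [fset x]%fset) => [|h].
  by rewrite big_seq_fset1 mulVg eqxx mulr1.
rewrite in_fset1 => /negPf hx.
by rewrite -(inj_eq (mulgI h)) mulVKg mulg1 eq_sym hx mulr0.
Qed.

Lemma convl_delta x : Defs.conv (fun g => (g == 1%g)%:R) mu x = mu x.
Proof.
rewrite /Defs.conv (fsbigTE [fset 1%g]%fset) => [|h].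
  by rewrite big_seq_fset1 eqxx invg1 mul1g mul1r.
by rewrite in_fset1 => /negPf ->; rewrite mul0r.
Qed.

(** Powers are defined by prepending a factor [mu]; they may as well be built by
    appending it, since the two operations commute by associativity. *)
Lemma conv_powSr n x : p n.+1 x = Defs.conv (p n) mu x.
Proof.
elim: n x => [|n IHn] x; first by rewrite /= convr_delta convl_delta.
rewrite convr_finE -[LHS]/(Defs.conv mu (p n.+1) x) convl_finE.
under eq_bigr do rewrite IHn convr_finE mulr_sumr.
rewrite exchange_big /=; apply: eq_bigr => k _.
rewrite convl_finE mulr_sumr; apply: eq_bigr => h _.
by rewrite mulrCA mulgA.
Qed.

Lemma conv_powV n x : p n x^-1%g = p n x.
Proof.
elim: n x => [|n IHn] x; first by rewrite /= invg_eq1.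
rewrite conv_powSr convr_finE -[RHS]/(Defs.conv mu (p n) x) convl_finE.
by apply: eq_bigr => h _; rewrite -[in RHS]IHn invgM invgK.
Qed.

Lemma greenC x y : green mu x y = green mu y x.
Proof.
by apply: eq_eseriesr => n _; rewrite -conv_powV invgM invgK.
Qed.

Lemma green_diag x : green mu x x = green mu 1%g 1%g.
Proof. by rewrite /green !mulVg. Qed.

Context (trG : transient R Gam).

Local Notation G x y := (fine (green mu x y)).

Lemma fine_green_gt0 x y : 0 < G x y.
Proof. by rewrite -lte_fin fineK ?green_gt0//; exact: trG. Qed.

Lemma green_partial_le x y n :
  \sum_(0 <= k < n) p k (x^-1 * y)%g <= G x y.
Proof.
rewrite -lee_fin fineK; last exact: trG.
rewrite -sumEFin; apply: nneseries_lim_ge => k _ _.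
by rewrite lee_fin conv_pow_ge0.
Qed.

Lemma green_le_bound x y (M : R) :
  (forall n, \sum_(0 <= k < n) p k (x^-1 * y)%g <= M) -> G x y <= M.
Proof.
move=> leM; rewrite -lee_fin fineK; last exact: trG.
apply: lime_le.
  by apply: is_cvg_nneseries => k _ _; rewrite lee_fin conv_pow_ge0.
by apply: nearW => n; rewrite sumEFin lee_fin.
Qed.

(** A walk from [z != y] to [y] must take a first step, over which [f]
    decreases in the mean; this is the induction step. At [z = y] the bound is
    that of a partial sum of [G(y,y) = G(e,e)]. *)
Lemma superharmonic_domination (f : Gam -> R) z y :
  (forall x, 0 <= f x) -> (forall x, Defs.conv f mu x <= f x) ->
  G z y * f y <= G 1%g 1%g * f z.
Proof.
move=> f0 fsup.
have G0 := fine_green_gt0 1%g 1%g.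
(* Dividing by [f y] isolates [G z y], which is the limit of its partial sums. *)
have [fy0|fy0] := eqVneq (f y) 0; first by rewrite fy0 mulr0 mulr_ge0// ltW.
have fy : 0 < f y by rewrite lt_def fy0 f0.
rewrite -ler_pdivlMr//; apply: green_le_bound => n; rewrite ler_pdivlMr//.
elim: n z => [|n IHn] z.
  by rewrite big_geq// mul0r mulr_ge0// ltW.
have [->|zy] := eqVneq z y.
  by rewrite ler_wpM2r// -(green_diag y) green_partial_le.
rewrite big_nat_recl//= -(inj_eq (mulgI z)) mulVKg mulg1 eq_sym (negPf zy) add0r.
under eq_bigr do rewrite convl_finE.
rewrite exchange_big /= mulr_suml.
apply: le_trans (_ : G 1%g 1%g * Defs.conv f mu z <= _); last first.
  by rewrite ler_pM2l.
rewrite convr_finE mulr_sumr; apply: ler_sum => h _.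
rewrite -mulr_sumr mulrCA -mulrA; apply: ler_wpM2l; first exact: adm_ge0.
under eq_bigr do rewrite mulgA -invgM.
exact: IHn.
Qed.

(** The domination principle for [f = K_x], cleared of the normalization
    [G(e,x)] of the Martin kernel. *)
Lemma green_submul z y x : G z y * G y x <= G 1%g 1%g * G z x.
Proof.
have [K0 Ksup] := martin_in_cone hmu trG x.
have := superharmonic_domination _ z y (fun t => ltW (K0 t)) Ksup.
by rewrite /martin !mulrA ler_pM2r// invr_gt0 fine_green_gt0.
Qed.

Lemma martin_ratioE x y z :
  martin mu y z / martin mu x z =
  G z y / G z x * (G 1%g x / G 1%g y).
Proof. by rewrite /martin invfM invrK mulrACA [_^-1 * _]mulrC. Qed.

End Green.

(** The relation [l * f <= g] bounds [l] above by the ratio [g / f] at every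
    point, and [g <= l * f] bounds it below, so [alpha] and [beta] are the infimum
    and the supremum of this ratio. Having them attained, at
    [u] and [v], makes both positive reals and keeps the distance finite. *)
Lemma hilbert_metric_attained {T : Type} {R : realType} {C : set (T -> R)}
    (F H : {f | C f}) (u v : T) (f := sval F) (g := sval H) :
  (forall z, 0 < f z) -> (forall z, 0 < g z) ->
  (forall z, g u / f u <= g z / f z) -> (forall z, g z / f z <= g v / f v) ->
  hilbert_metric F H = (2^-1 * ln (g v / f v / (g u / f u)))%:E.
Proof.
move=> f0 g0 minu maxv.
have r0 z : 0 < g z / f z by rewrite divr_gt0.
have alphaE : hilbert_alpha f g = (g u / f u)%:E.
  rewrite /hilbert_alpha; set S := ereal_sup _.
  suff -> : S = (g u / f u)%:E by rewrite max_r// lee_fin ltW.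
  apply/eqP; rewrite eq_le; apply/andP; split.
    apply: ge_ereal_sup => _ [l [_ lfg] <-].
    by rewrite lee_fin ler_pdivlMr// lfg.
  apply: ereal_sup_ubound; exists (g u / f u) => //; split => // z.
  by rewrite -ler_pdivlMr.
have betaE : hilbert_beta f g = (g v / f v)%:E.
  apply/eqP; rewrite eq_le; apply/andP; split.
    apply: ereal_inf_lbound; exists (g v / f v) => //; split => // z.
    by rewrite -ler_pdivrMr.
  apply: le_ereal_inf_tmp => _ [l [_ lfg] <-].
  by rewrite lee_fin ler_pdivrMr// lfg.
rewrite /hilbert_metric -/f -/g alphaE betaE inver gt_eqF// -EFinM.
by rewrite lne_EFin ?divr_gt0// -EFinM.
Qed.

Theorem lemma2p1 (R : realType) (Gam : groupType)
  (fgG : finitely_generated Gam) (trG : transient R Gam)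
  (mu : Gam -> R) (hmu : admissible mu) :
  forall x y : Gam, martin_dist trG hmu x y = (green_metric mu x y)%:E.
Proof.
move=> x y.
have G0 a b := fine_green_gt0 hmu trG a b.
have K0 t z : 0 < martin mu t z by case: (martin_in_cone hmu trG t).
rewrite /martin_dist (hilbert_metric_attained _ _ x y) /= => [|||z|z] //.
- congr (_%:E); rewrite /green_metric !martin_ratioE
    (green_diag x) (green_diag y) (greenC hmu y x).
  set a := fine (green mu 1%g 1%g); set b := fine (green mu x y).
  have ab0 : 0 < a / b by rewrite divr_gt0 ?G0.
  rewrite [X in ln X](_ : _ = (a / b) ^+ 2).
    by rewrite lnXn// -[ln _ *+ 2]mulr_natl mulKf// pnatr_eq0.
  rewrite -mulf_div divff ?mulr1; last by rewrite gt_eqF// divr_gt0.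
  by rewrite invf_div expr2.
- rewrite !martin_ratioE ler_pM2r ?divr_gt0//.
  rewrite ler_pdivrMr// mulrAC ler_pdivlMr// green_diag mulrC.
  by rewrite [leRHS]mulrC green_submul.
- rewrite !martin_ratioE ler_pM2r ?divr_gt0//.
  rewrite ler_pdivrMr// mulrAC ler_pdivlMr// green_diag.
  exact: green_submul.
Qed.
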